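(* Let $f_1,\dots,f_m:\mathbb{R}^d\to\mathbb{R}$, $w_1,\dots,w_m>0$, $\varepsilon,\delta\ge0$, $\{\boldsymbol\theta^\star_j\}\subseteq\mathbb{R}^d$, $0<M\le+\infty$, $0<\rho\le L<+\infty$, and suppose there is $S\subseteq[m]$ such that: each $f_j$, $j\in S$, is $(\boldsymbol\theta^\star_j,M,\rho,L)$-regular; $\min_{\boldsymbol\theta\in\mathbb{R}^d}\max_{j\in S}\sqrt{w_j}\|\boldsymbol\theta^\star_j-\boldsymbol\theta\|_2\le\delta$; and $\sum_{j\in S^c}\sqrt{w_j}\le\varepsilon\sum_{j\in S}w_j/\max_{j\in S}\sqrt{w_j}$. Let $\kappa=L/\rho$, $\kappa_w=\max_{j\in S}\sqrt{w_j}\cdot\sum_{j\in S}\sqrt{w_j}/\sum_{j\in S}w_j$, assume $\kappa\varepsilon<1$ and $$\frac{5\kappa\kappa_w}{1-\kappa\varepsilon}\max_{j\in S}\{\sqrt{w_j}\|\nabla f_j(\boldsymbol\theta^\star_j)\|_2\}<\lambda<\frac{\rho M}{2}\min_{j\in S}\sqrt{w_j}.$$ Let $(\widehat{\boldsymbol\Theta},\widehat{\boldsymbol\beta})\in\mathop{\mathrm{argmin}}_{\boldsymbol\Theta\in\mathbb{R}^{d\times m},\boldsymbol\beta\in\mathbb{R}^d}\{\sum_{j=1}^mw_j(f_j(\boldsymbol\theta_j)+\frac{\lambda}{\sqrt{w_j}}\|\boldsymbol\beta-\boldsymbol\theta_j\|_2)\}$. Then for all $j\in S$, $$\|\widehat{\boldsymbol\theta}_j-\boldsymbol\theta^\star_j\|_2\le\frac{\|\sum_{k\in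 S}w_k\nabla f_k(\boldsymbol\theta^\star_k)\|_2}{\rho\sum_{k\in S}w_k}+\frac{6}{(1-\kappa\varepsilon)\sqrt{w_j}}\min\Big\{3\kappa^2\kappa_w\delta,\frac{2\lambda}{5\rho}\Big\}+\frac{\varepsilon\lambda}{\rho\max_{k\in S}\sqrt{w_k}}.$$ Moreover, there exists a constant $C$ such that if $\varepsilon=0$ and $C\kappa\kappa_wL\delta<\lambda$, then $\widehat{\boldsymbol\theta}_1=\dots=\widehat{\boldsymbol\theta}_m=\mathop{\mathrm{argmin}}_{\boldsymbol\theta\in\mathbb{R}^d}\{\sum_{j=1}^mw_jf_j(\boldsymbol\theta)\}$.
   Context: A function $f:\mathbb{R}^d\to\mathbb{R}$ is $(\boldsymbol\theta^\star,M,\rho,L)$-regular if it is convex and twice differentiable, $\rho\boldsymbol I\preceq\nabla^2f(\boldsymbol\theta)\preceq L\boldsymbol I$ for all $\boldsymbol\theta$ in the closed ball $B(\boldsymbol\theta^\star,M)$, and $\|\nabla f(\boldsymbol\theta^\star)\|_2\le\rho M/2$. *)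

(* Defs.v *)
From HB Require Import structures.
From mathcomp Require Import all_boot all_order all_algebra.
From mathcomp Require Import all_classical all_reals all_analysis.
Set Implicit Arguments. Unset Strict Implicit. Unset Printing Implicit Defensive.
Import Order.TTheory GRing.Theory Num.Theory.
Import numFieldNormedType.Exports.
Local Open Scope ring_scope.

Section Defs.
Variables (R : realType) (d : nat).
Local Notation V := 'rV[R]_d.

Definition norm2 (v : V) : R := Num.sqrt (\sum_(i < d) v ord0 i ^+ 2).

Definition ebasis (i : 'I_d) : V := delta_mx ord0 i.

Definition grad (f : V -> R) (x : V) : V := \row_(i < d) derive f x (ebasis i).

Definition hessian (f : V -> R) (x : V) : 'M[R]_d :=
  \matrix_(i < d, k < d) derive (fun y => derive f y (ebasis i)) x (ebasis k).

Definition loewner_le (A B : 'M[R]_d) : Prop :=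
  forall v : V, (v *m A *m v^T) ord0 ord0 <= (v *m B *m v^T) ord0 ord0.

Definition convex_fun (f : V -> R) : Prop :=
  forall (x y : V) (t : R), 0 <= t -> t <= 1 ->
    f (t *: x + (1 - t) *: y) <= t * f x + (1 - t) * f y.

Definition twice_differentiable (f : V -> R) : Prop :=
  (forall x, differentiable f x) /\
  (forall (u x : V), differentiable (fun y => derive f y u) x).

Definition regular (f : V -> R) (thstar : V) (M : \bar R) (rho L : R) : Prop :=
  [/\ convex_fun f, twice_differentiable f,
      (forall th : V, ((norm2 (th - thstar))%:E <= M)%E ->
         loewner_le (rho%:M) (hessian f th) /\ loewner_le (hessian f th) (L%:M))
    & ((norm2 (grad f thstar))%:E <= (rho / 2)%:E * M)%E].

End Defs.


(* The standing setting of Theorem A.2. Theta is given by its columns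
   Th j = theta_j (j in [m]). *)
Definition settingA2 (R : realType) (d m : nat) (f : 'I_m -> 'rV[R]_d -> R)
  (w : 'I_m -> R) (eps delta : R) (thstar : 'I_m -> 'rV[R]_d) (M : \bar R)
  (rho L : R) (S : {set 'I_m}) (lam : R)
  (Thhat : 'I_m -> 'rV[R]_d) (bhat : 'rV[R]_d) : Prop :=
  let maxsw := \big[Num.max/0]_(j in S) Num.sqrt (w j) in
  let kappa := L / rho in
  let kappaw := maxsw * (\sum_(j in S) Num.sqrt (w j)) / (\sum_(j in S) w j) in
  [/\ (forall j, 0 < w j), 0 <= eps, 0 <= delta & (0 < M)%E] /\
  [/\ 0 < rho, rho <= L & S != finset.set0] /\
   [/\ (forall j, j \in S -> regular (f j) (thstar j) M rho L),
       (exists th : 'rV[R]_d,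
          \big[Num.max/0]_(j in S) (Num.sqrt (w j) * norm2 (thstar j - th)) <= delta),
       \sum_(j in ~: S) Num.sqrt (w j) <= eps * (\sum_(j in S) w j) / maxsw &
       kappa * eps < 1] /\
   (5 * kappa * kappaw / (1 - kappa * eps) *
          \big[Num.max/0]_(j in S) (Num.sqrt (w j) * norm2 (grad (f j) (thstar j)))
          < lam) /\
       (* lam < rho M / 2 * min_{j in S} sqrt w_j, min written out *)
       (forall j, j \in S -> (lam%:E < (rho / 2 * Num.sqrt (w j))%:E * M)%E) /\
   forall (Th : 'I_m -> 'rV[R]_d) (b : 'rV[R]_d),
     \sum_(j < m) w j * (f j (Thhat j) + lam / Num.sqrt (w j) * norm2 (bhat - Thhat j))
     <= \sum_(j < m) w j * (f j (Th j) + lam / Num.sqrt (w j) * norm2 (b - Th j)).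

(* Main.v *)
Require Import Defs.
From HB Require Import structures.
From mathcomp Require Import all_boot all_order all_algebra.
From mathcomp Require Import all_classical all_reals all_analysis.
From mathcomp Require Import ring lra.
Import Order.TTheory GRing.Theory Num.Theory.
Import numFieldNormedType.Exports.
Local Open Scope ring_scope.
Set Implicit Arguments. Unset Strict Implicit. Unset Printing Implicit Defensive.

(* Optimality gives three facts: the gradient of f_j at the j-th column has norm
   at most lambda / sqrt w_j; it has exactly this norm and points towards bhat
   unless the column equals bhat; and, translating the columns in S together with
   bhat, the weighted sum over S of these gradients is bounded by the total
   penalty slope outside S. The first fact and strong convexity put each column
   within 6 lambda / (5 rho sqrt w_j) of theta*_j, which settles the case of
   large delta. For small delta let x be the common center. Each column
   gradient minus grad f_j x, paired with bhat - x, exceeds rho r |bhat - x| as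
   soon as |bhat - x| > r, since a column different from bhat is at distance
   more than r from x; for a suitable r this contradicts the third fact. So
   |bhat - x| <= r, there all gradients are below the threshold
   lambda / sqrt w_j, hence all columns in S equal bhat, and strong convexity
   around x bounds |bhat - x|. For eps = 0 every column is in S. *)

(** * Euclidean geometry *)

Section Euclidean.
Context {R : realType} {d : nat}.
Implicit Types (u v x y : 'rV[R]_d) (a : R).

Definition dot u v : R := (u *m v^T) ord0 ord0.

Lemma dotE u v : dot u v = \sum_i u ord0 i * v ord0 i.
Proof. by rewrite /dot !mxE; apply: eq_bigr => i _; rewrite !mxE. Qed.

Lemma dotC u v : dot u v = dot v u.
Proof. by rewrite !dotE; apply: eq_bigr => i _; rewrite mulrC. Qed.

Lemma dotDl u v x : dot (u + v) x = dot u x + dot v x.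
Proof. by rewrite /dot mulmxDl mxE. Qed.

Lemma dotDr u v x : dot x (u + v) = dot x u + dot x v.
Proof. by rewrite !(dotC x) dotDl. Qed.

Lemma dotZl a u v : dot (a *: u) v = a * dot u v.
Proof. by rewrite /dot -scalemxAl mxE. Qed.

Lemma dotZr a u v : dot u (a *: v) = a * dot u v.
Proof. by rewrite !(dotC u) dotZl. Qed.

Lemma dotNl u v : dot (- u) v = - dot u v.
Proof. by rewrite -scaleN1r dotZl mulN1r. Qed.

Lemma dotNr u v : dot u (- v) = - dot u v.
Proof. by rewrite !(dotC u) dotNl. Qed.

Lemma dotBl u v x : dot (u - v) x = dot u x - dot v x.
Proof. by rewrite dotDl dotNl. Qed.

Lemma dotBr u v x : dot x (u - v) = dot x u - dot x v.
Proof. by rewrite dotDr dotNr. Qed.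

Lemma dot_suml (I : finType) (P : pred I) (F : I -> 'rV[R]_d) x :
  dot (\sum_(i | P i) F i) x = \sum_(i | P i) dot (F i) x.
Proof. by rewrite /dot mulmx_suml summxE. Qed.

Lemma norm2_ge0 u : 0 <= norm2 u.
Proof. exact: sqrtr_ge0. Qed.

Lemma dotvv u : dot u u = norm2 u ^+ 2.
Proof.
rewrite sqr_sqrtr; last by apply: sumr_ge0 => i _; exact: sqr_ge0.
by rewrite dotE; apply: eq_bigr => i _; rewrite expr2.
Qed.

Lemma norm2_eq0 u : norm2 u = 0 -> u = 0.
Proof.
move=> u0; have : dot u u = 0 by rewrite dotvv u0 expr0n.
rewrite dotE => /eqP; rewrite psumr_eq0 => [/allP u0'|i _]; last first.
  by rewrite -expr2 sqr_ge0.
apply/rowP => i; have := u0' i (mem_index_enum _); rewrite -expr2 sqrf_eq0.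
by rewrite mxE => /eqP.
Qed.

Lemma norm2_gt0 u : u != 0 -> 0 < norm2 u.
Proof.
move=> u0; rewrite lt0r norm2_ge0 andbT; apply: contra u0 => /eqP.
by move/norm2_eq0 => ->.
Qed.

Lemma norm2Z a u : norm2 (a *: u) = `|a| * norm2 u.
Proof.
apply/eqP; rewrite -(@eqrXn2 _ 2) ?norm2_ge0 ?mulr_ge0 ?norm2_ge0//.
by rewrite -dotvv dotZl dotZr dotvv exprMn real_normK ?num_real// mulrA expr2.
Qed.

Lemma norm20 : norm2 (0 : 'rV[R]_d) = 0.
Proof. by rewrite -(scale0r 0) norm2Z normr0 mul0r. Qed.

Lemma norm2N u : norm2 (- u) = norm2 u.
Proof. by rewrite -scaleN1r norm2Z normrN1 mul1r. Qed.

Lemma norm2B u v : norm2 (u - v) = norm2 (v - u).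
Proof. by rewrite -norm2N opprB. Qed.

(** Cauchy-Schwarz: expand the square of [norm2 v *: u - norm2 u *: v] and divide by
    [2 * (norm2 u * norm2 v)]. *)
Lemma dot_le u v : dot u v <= norm2 u * norm2 v.
Proof.
have [->|u0] := eqVneq u 0.
  by rewrite norm20 mul0r -(scale0r 0) dotZl mul0r.
have [->|v0] := eqVneq v 0.
  by rewrite norm20 mulr0 -(scale0r 0) dotZr mul0r.
have up := norm2_gt0 u0; have vp := norm2_gt0 v0.
have h : 0 <= dot (norm2 v *: u - norm2 u *: v) (norm2 v *: u - norm2 u *: v).
  by rewrite dotvv sqr_ge0.
move: h; rewrite dotBl !dotBr !dotZl !dotZr (dotC v u) !dotvv => h.
have : 0 <= (2 * (norm2 u * norm2 v)) * (norm2 u * norm2 v - dot u v) by lra.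
by rewrite pmulr_rge0 ?subr_ge0// !mulr_gt0.
Qed.

Lemma norm2D u v : norm2 (u + v) <= norm2 u + norm2 v.
Proof.
rewrite -(@ler_pXn2r _ 2) ?nnegrE ?addr_ge0 ?norm2_ge0//.
rewrite -dotvv dotDl !dotDr (dotC v u) !dotvv.
by have := dot_le u v; lra.
Qed.

Lemma norm2_tri x y v : norm2 (x - v) <= norm2 (x - y) + norm2 (y - v).
Proof. by rewrite -(subrKA y) norm2D. Qed.

Lemma norm2_sum (I : finType) (P : pred I) (F : I -> 'rV[R]_d) :
  norm2 (\sum_(i | P i) F i) <= \sum_(i | P i) norm2 (F i).
Proof.
elim/big_ind2: _ => [|u a v b ua vb|//]; first by rewrite norm20.
by rewrite (le_trans (norm2D _ _)) ?lerD.
Qed.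

(** Turns bounds on directional derivatives into a gradient bound; testing with [v = - u]
    suffices. *)
Lemma norm2_le_dual u a : 0 <= a ->
  (forall v, - (a * norm2 v) <= dot u v) -> norm2 u <= a.
Proof.
move=> a0 h; have [->//|u0] := eqVneq u 0; first by rewrite norm20.
have up := norm2_gt0 u0.
have := h (- u); rewrite norm2N dotNr dotvv lerN2 expr2.
by rewrite ler_pM2r.
Qed.

End Euclidean.

(** * Gradients of convex functions *)

Section Lines.
Context {R : realType} {d : nat}.
Implicit Types (f : 'rV[R]_d -> R) (u v x y : 'rV[R]_d).

Lemma is_derive_line f x v (t : R) : differentiable f (x + t *: v) ->
  is_derive t 1 (fun s : R => f (x + s *: v)) ('D_v f (x + t *: v)).
Proof.
move=> df; set phi := fun s => _.
have E : (fun h : R => h^-1 *: ((phi \o shift t) (h *: 1) - phi t)) =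
   (fun h : R => h^-1 *: ((f \o shift (x + t *: v)) (h *: v) - f (x + t *: v))).
  apply/funext => h; rewrite /phi /= /shift /=; congr (_ *: (f _ - _)).
  by rewrite [h *: 1]mulr1 scalerDl addrCA.
have dv : derivable f (x + t *: v) v by exact: diff_derivable.
by apply: DeriveDef; [rewrite /derivable E | rewrite /derive E].
Qed.

Lemma derive_dot f x v : differentiable f x -> 'D_v f x = dot (grad f x) v.
Proof.
move=> df; rewrite deriveE// [v in LHS]row_sum_delta linear_sum dotE.
apply: eq_bigr => i _; rewrite linearZ /= mxE.
by rewrite -deriveE// [LHS]mulrC.
Qed.

(** If [D < c], the difference quotients near 0 lie below [c]. Only increments at [t > 0] enter,
    which suits comparisons with a nonsmooth penalty. *)
Lemma derive_ge (phi : R -> R) (D c : R) : is_derive (0 : R) 1 phi D ->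
  (forall t, 0 < t -> t <= 1 -> t * c <= phi t - phi 0) -> c <= D.
Proof.
move=> [dphi <-] h; rewrite leNgt; apply/negP => Dc.
have := cvgr_lt _ dphi _ Dc.
move=> [e /= e0 He].
set t := Num.min (e / 2) 1.
have t0 : 0 < t by rewrite lt_min ltr01 andbT divr_gt0.
have t1 : t <= 1 by rewrite ge_min lexx orbT.
have te : t < e by rewrite gt_min ltr_pdivrMr// ltr_pMr// ltr1n.
have := He t; rewrite /ball_ /= sub0r normrN gtr0_norm// => /(_ te).
rewrite gt_eqF// => /(_ isT); rewrite /shift /= addr0 [t *: 1]mulr1.
rewrite [_ *: _]mulrC ltr_pdivrMr// ltNge mulrC h//.
Qed.

End Lines.

Section Convex.
Context {R : realType} {d : nat}.
Implicit Types (f : 'rV[R]_d -> R) (u v x y c : 'rV[R]_d).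

Lemma convex_grad_le f x y : convex_fun f -> differentiable f x ->
  dot (grad f x) (y - x) <= f y - f x.
Proof.
(* Convexity bounds the increments along the segment from above, so [derive_ge] is applied to the
   negated restriction. *)
move=> cf df; rewrite -lerN2 -derive_dot//.
have := @is_derive_line _ _ f x (y - x) 0.
rewrite scale0r addr0 => /(_ df) /is_deriveN; set g := fun s => _ => dg.
apply: (@derive_ge _ (- g)) => // t t0 t1.
have := cf y x t (ltW t0) t1.
have -> : t *: y + (1 - t) *: x = x + t *: (y - x).
  by apply/rowP => i; rewrite !mxE; ring.
by rewrite /g !fctE scale0r addr0; lra.
Qed.

Lemma convex_grad_mono f x y : convex_fun f ->
  differentiable f x -> differentiable f y ->
  0 <= dot (grad f y - grad f x) (y - x).
Proof.
move=> cf dx dy; have := convex_grad_le y cf dx.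
have := convex_grad_le x cf dy.
by rewrite -(opprB y x) dotNr dotBl; lra.
Qed.

Lemma derive2_hessian f x v : twice_differentiable f ->
  'D_v (fun y => 'D_v f y) x = (v *m hessian f x *m v^T) ord0 ord0.
Proof.
move=> [df d2f].
have -> : (fun y => 'D_v f y) =
    \sum_(i < d) (fun y => v ord0 i *: 'D_(ebasis R i) f y).
  apply/funext => y; rewrite fct_sumE derive_dot// dotE.
  by apply: eq_bigr => i _; rewrite mxE mulrC.
have dZ (i : 'I_d) u z : derivable (fun y => 'D_(ebasis R i) f y) z u.
  exact: diff_derivable.
rewrite derive_sum => [|i]; last by apply: derivableZ; exact: dZ.
rewrite -mulmxA mxE; apply: eq_bigr => i _.
rewrite deriveZ; last exact: dZ.
congr (_ * _).
rewrite derive_dot// dotE mxE; apply: eq_bigr => k _; by rewrite !mxE.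
Qed.

Lemma ball_seg c x y (t M : R) : 0 <= t -> t <= 1 ->
  norm2 (x - c) <= M -> norm2 (y - c) <= M ->
  norm2 (x + t *: (y - x) - c) <= M.
Proof.
move=> t0 t1 xM yM.
have -> : x + t *: (y - x) - c = (1 - t) *: (x - c) + t *: (y - c).
  by apply/rowP => i; rewrite !mxE; ring.
apply: le_trans (norm2D _ _) _; rewrite !norm2Z !ger0_norm ?subr_ge0//.
have : (1 - t) * norm2 (x - c) <= (1 - t) * M by rewrite ler_wpM2l ?subr_ge0.
have : t * norm2 (y - c) <= t * M by rewrite ler_wpM2l.
lra.
Qed.

(** Mean value theorem for the directional derivative along the segment: a Hessian bound at a single
    point then controls the gradient increment. *)
Lemma grad_MVT f x y : twice_differentiable f ->
  exists t, [/\ 0 <= t, t <= 1 & dot (grad f y - grad f x) (y - x) =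
    ((y - x) *m hessian f (x + t *: (y - x)) *m (y - x)^T) ord0 ord0].
Proof.
move=> tdf; have [df d2f] := tdf; set v := y - x.
have dphi (t : R) : is_derive t 1 (fun s : R => 'D_v f (x + s *: v))
    ('D_v (fun y => 'D_v f y) (x + t *: v)).
  exact: (is_derive_line (f := fun y => 'D_v f y)).
have [|t /itvP tI] := @MVT_segment R _ _ 0 1 ler01 (fun t _ => dphi t).
  apply: derivable_within_continuous => t _.
  exact: (@ex_derive _ _ _ _ _ _ _ (dphi t)).
rewrite scale0r addr0 scale1r subr0 mulr1 {1}/v subrKC !(derive_dot _ (df _)).
by rewrite -dotBl derive2_hessian// => E; exists t; rewrite !tI.
Qed.

Lemma quad_scalar (a : R) v : (v *m a%:M *m v^T) ord0 ord0 = a * norm2 v ^+ 2.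
Proof. by rewrite mul_mx_scalar -scalemxAl mxE -dotvv. Qed.

Lemma hessian_grad_le f c x y (M L : R) : twice_differentiable f ->
  (forall z, norm2 (z - c) <= M -> loewner_le (hessian f z) (L%:M)) ->
  norm2 (x - c) <= M -> norm2 (y - c) <= M ->
  dot (grad f y - grad f x) (y - x) <= L * norm2 (y - x) ^+ 2.
Proof.
move=> tdf hf xM yM; have [t [t0 t1 ->]] := grad_MVT x y tdf.
have := hf (x + t *: (y - x)); rewrite ball_seg// => /(_ isT (y - x)).
by rewrite quad_scalar.
Qed.

Lemma hessian_grad_ge f c x y (M rho : R) : twice_differentiable f ->
  (forall z, norm2 (z - c) <= M -> loewner_le (rho%:M) (hessian f z)) ->
  norm2 (x - c) <= M -> norm2 (y - c) <= M ->
  rho * norm2 (y - x) ^+ 2 <= dot (grad f y - grad f x) (y - x).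
Proof.
move=> tdf hf xM yM; have [t [t0 t1 ->]] := grad_MVT x y tdf.
have := hf (x + t *: (y - x)); rewrite ball_seg// => /(_ isT (y - x)).
by rewrite quad_scalar.
Qed.

Lemma descent f c x y (M L : R) : twice_differentiable f ->
  (forall z, norm2 (z - c) <= M -> loewner_le (hessian f z) (L%:M)) ->
  norm2 (x - c) <= M -> norm2 (y - c) <= M ->
  f y <= f x + dot (grad f x) (y - x) + L / 2 * norm2 (y - x) ^+ 2.
Proof.
move=> tdf hf xM yM; have [df d2f] := tdf; set v := y - x.
set D := dot (grad f x) v; set q := L / 2 * norm2 v ^+ 2.
(* Subtract the claimed quadratic bound; by [hessian_grad_le] the derivative of [g] is nonpositive
   on the open unit interval. *)
pose g (t : R) := f (x + t *: v) - (D * t + q * t ^+ 2).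
have dg (t : R) : is_derive t 1 g (dot (grad f (x + t *: v)) v - (D + q * (2 * t))).
  apply: is_deriveB; first by rewrite -derive_dot//; exact: is_derive_line.
  apply: is_derive_eq; rewrite /GRing.scale /=; ring.
have [|t /itvP tI] := @MVT R _ _ 0 1 ltr01 (fun t _ => dg t).
  apply: derivable_within_continuous => t _.
  exact: (@ex_derive _ _ _ _ _ _ _ (dg t)).
rewrite /g scale0r addr0 scale1r {1}/v subrKC => gE.
have t0 : 0 < t by rewrite tI.
have := @hessian_grad_le f c x (x + t *: v) M L tdf hf xM.
rewrite ball_seg ?tI// => /(_ isT).
rewrite addrAC subrr add0r norm2Z gtr0_norm// dotZr dotBl -/D exprMn.
move=> h.
have : t * (dot (grad f (x + t *: v)) v - (D + q * (2 * t))) <= 0.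
  by rewrite /q; lra.
rewrite pmulr_rle0// => h'.
move: gE; lra.
Qed.

(* Unless [grad f] is [L]-Lipschitz between [x] and [y], a step of length
   [norm2 (y - x)] from [x] along [grad f y - grad f x] takes the convex
   function [f - dot (grad f y)] below its minimum, which is attained at [y].
   This needs no symmetry of the Hessian. *)
Lemma hessian_grad_lipschitz f c x y (M L : R) : 0 <= L ->
  convex_fun f -> twice_differentiable f ->
  (forall z, norm2 (z - c) <= M -> loewner_le (hessian f z) (L%:M)) ->
  norm2 (x - c) + norm2 (y - x) <= M ->
  norm2 (grad f y - grad f x) <= L * norm2 (y - x).
Proof.
move=> L0 cf tdf hf xyM; have [df _] := tdf.
have n0 := norm2_ge0 (y - x).
have xM : norm2 (x - c) <= M by lra.
have yM : norm2 (y - c) <= M.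
  by apply: le_trans (norm2_tri _ x _) _; rewrite addrC.
set e := grad f y - grad f x; set n := norm2 (y - x).
rewrite leNgt; apply/negP => en.
have e0 : 0 < norm2 e by apply: le_lt_trans en; rewrite mulr_ge0.
set z := x + (n / norm2 e) *: e.
have zx : z - x = (n / norm2 e) *: e by rewrite /z addrAC subrr add0r.
have nzx : norm2 (z - x) = n.
  by rewrite zx norm2Z ger0_norm ?divr_ge0 ?norm2_ge0// divfK// gt_eqF.
have zM : norm2 (z - c) <= M.
  by apply: le_trans (norm2_tri _ x _) _; rewrite nzx addrC.
have dez : dot e (z - x) = n * norm2 e.
  by rewrite zx dotZr dotvv expr2 mulrA divfK// gt_eqF.
(* Adding [h1], [h2] and [h3] cancels all values of [f] and leaves [n * norm2 e <= L * n ^+ 2]. *)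
have h1 := descent tdf hf xM zM.
have h2 := descent tdf hf yM xM.
have h3 := convex_grad_le z cf (df y).
have zyE : dot (grad f y) (z - y) =
    dot (grad f y) (z - x) - dot (grad f y) (y - x).
  by rewrite -dotBr opprB addrA subrK.
move: h1 h2 h3; rewrite nzx (norm2B x y) -/n zyE -(opprB y x) dotNr.
move: dez; rewrite /e dotBl.
have n_gt0 : 0 < n.
  rewrite lt0r n0 andbT; apply/eqP => nz.
  have yx : y = x by apply/eqP; rewrite -subr_eq0 (norm2_eq0 nz).
  by move: e0; rewrite /e yx subrr norm20 ltxx.
have : n * (L * n) < n * norm2 e by rewrite ltr_pM2l.
rewrite /e; lra.
Qed.

End Convex.

(** * Gradient estimates for functions regular on a ball *)

Section RegularOn.
Context {R : realType} {d : nat}.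
Implicit Types (f : 'rV[R]_d -> R) (u v x y c b p : 'rV[R]_d).

(** The convexity and Hessian conditions of [regular], with a real radius; [real_radius] supplies
    one even when [M] is infinite. *)
Definition regular_on f c (M rho L : R) : Prop :=
  [/\ convex_fun f, twice_differentiable f &
      forall z, norm2 (z - c) <= M ->
        loewner_le (rho%:M) (hessian f z) /\ loewner_le (hessian f z) (L%:M)].

Lemma regular_on_diff f c M rho L : regular_on f c M rho L ->
  forall x, differentiable f x.
Proof. by case=> _ []. Qed.

Lemma regular_on_mono f c M rho L x y : regular_on f c M rho L ->
  0 <= dot (grad f y - grad f x) (y - x).
Proof. by case=> cf [df _] _; exact: convex_grad_mono. Qed.

Lemma regular_on_lipschitz f c M rho L x y : 0 <= L ->
  regular_on f c M rho L -> norm2 (x - c) + norm2 (y - x) <= M ->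
  norm2 (grad f y - grad f x) <= L * norm2 (y - x).
Proof.
move=> L0 [cf tdf hf]; apply: hessian_grad_lipschitz => // z zM.
by have [] := hf z zM.
Qed.

(** [y] may lie outside the ball: strong convexity acts on the fraction [t] of the segment,
    monotonicity on the rest. *)
Lemma regular_on_growth f c M rho L x y t : regular_on f c M rho L ->
  0 < t -> t <= 1 -> norm2 (x - c) <= M -> norm2 (x + t *: (y - x) - c) <= M ->
  rho * t * norm2 (y - x) ^+ 2 <= dot (grad f y - grad f x) (y - x).
Proof.
move=> rf t0 t1 xM zM; have [cf tdf hf] := rf; set v := y - x.
have h1 : rho * t * norm2 v ^+ 2 <= dot (grad f (x + t *: v) - grad f x) v.
  have hge z : norm2 (z - c) <= M -> loewner_le (rho%:M) (hessian f z).
    by move=> /hf[].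
  have := hessian_grad_ge tdf hge xM zM; rewrite addrAC subrr add0r.
  rewrite norm2Z gtr0_norm// dotZr exprMn => h.
  by rewrite -(ler_pM2l t0); apply: le_trans h; rewrite -/v; lra.
apply: le_trans h1 _; move: t1; rewrite le_eqVlt => /predU1P[->|t1].
  by rewrite scale1r /v subrKC.
have := regular_on_mono (x + t *: v) y rf.
have -> : y - (x + t *: v) = (1 - t) *: v.
  by rewrite opprD addrA scalerBl scale1r.
rewrite dotZr pmulr_rge0 ?subr_gt0// !dotBl; lra.
Qed.

Lemma regular_on_strict_mono f c M rho L x y : regular_on f c M rho L ->
  0 < rho -> norm2 (x - c) < M -> y != x ->
  0 < dot (grad f y - grad f x) (y - x).
Proof.
move=> rf rho0 xM yx.
have v0 : 0 < norm2 (y - x) by rewrite norm2_gt0// subr_eq0.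
pose t := Num.min 1 ((M - norm2 (x - c)) / norm2 (y - x)).
have t0 : 0 < t by rewrite lt_min ltr01 divr_gt0// subr_gt0.
have t1 : t <= 1 by rewrite ge_min lexx.
have tv : t * norm2 (y - x) <= M - norm2 (x - c).
  by rewrite -ler_pdivlMr// ge_min lexx orbT.
apply: lt_le_trans (regular_on_growth rf t0 t1 (ltW xM) _).
  by rewrite !mulr_gt0// exprn_gt0.
rewrite addrAC; apply: le_trans (norm2D _ _) _; rewrite norm2Z gtr0_norm//; lra.
Qed.

(* [p] may lie outside the ball: growth along the ray from [c] to [p] already
   forces a large gradient difference at distance [M]. *)
Lemma regular_on_near f c M rho L p (K : R) : regular_on f c M rho L ->
  0 < M -> norm2 (grad f p) + norm2 (grad f c) <= K -> K < rho * M ->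
  rho * norm2 (p - c) <= K.
Proof.
move=> rf M0 pK KM.
have cM : norm2 (c - c) <= M by rewrite subrr norm20 ltW.
have K0 : 0 <= K by apply: le_trans pK; rewrite addr_ge0 ?norm2_ge0.
have [D0|] := eqVneq (norm2 (p - c)) 0; first by rewrite D0 mulr0.
move=> D0; have {}D0 : 0 < norm2 (p - c) by rewrite lt0r D0 norm2_ge0.
have up : dot (grad f p - grad f c) (p - c) <= K * norm2 (p - c).
  apply: le_trans (dot_le _ _) _; rewrite ler_wpM2r ?norm2_ge0//.
  by apply: le_trans (norm2D _ _) _; rewrite norm2N.
have key t : 0 < t -> t <= 1 -> t * norm2 (p - c) <= M ->
    rho * (t * norm2 (p - c)) <= K.
  move=> t0 t1 tM; rewrite -(ler_pM2r D0); apply: le_trans up.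
  apply: le_trans (regular_on_growth rf t0 t1 cM _); first by rewrite expr2 !mulrA.
  by rewrite addrAC subrr add0r norm2Z gtr0_norm.
have [DM|MD] := leP (norm2 (p - c)) M.
  by have := key 1 ltr01 (lexx _); rewrite mul1r; apply.
(* Beyond the ball, a step of length [M] gives [rho * M <= K], against [KM]. *)
have := key (M / norm2 (p - c)); rewrite divfK ?gt_eqF// => /(_ _ _ (lexx _)).
by rewrite divr_gt0// ler_pdivrMr// mul1r (ltW MD) => /(_ isT isT); lra.
Qed.

End RegularOn.

(** * First-order conditions *)

Section FirstOrder.
Context {R : realType} {d : nat}.
Implicit Types (f : 'rV[R]_d -> R) (u v x y c b p : 'rV[R]_d).

(** One-sided optimality when all points [p i] move along the same [v]. *)
Lemma dot_sum_grad_ge (I : finType) (P : pred I) (f : I -> 'rV[R]_d -> R)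
    (w : I -> R) (p : I -> 'rV[R]_d) v (c : R) :
  (forall i, P i -> differentiable (f i) (p i)) ->
  (forall t, 0 < t -> t <= 1 ->
    t * c <= \sum_(i | P i) w i * (f i (p i + t *: v) - f i (p i))) ->
  c <= dot (\sum_(i | P i) w i *: grad (f i) (p i)) v.
Proof.
move=> df h.
pose phi := \sum_(i | P i) (fun t : R => w i *: f i (p i + t *: v)).
have dphi : is_derive (0 : R) 1 phi (dot (\sum_(i | P i) w i *: grad (f i) (p i)) v).
  rewrite dot_suml /phi.
  elim/big_ind2 : _ => [|phi1 D1 phi2 D2 h1 h2|i Pi].
  - exact: is_derive_cst.
  - exact: is_deriveD.
  rewrite dotZl; apply: is_deriveZ; rewrite -derive_dot; last exact: df.
  have := @is_derive_line _ _ (f i) (p i) v 0; rewrite scale0r addr0.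
  by apply; exact: df.
apply: (derive_ge dphi) => t t0 t1; apply: le_trans (h t t0 t1) _.
rewrite /phi !fct_sumE -sumrB; apply: ler_sum => i Pi.
by rewrite scale0r addr0 mulrBr.
Qed.

Lemma dot_grad_ge f p v (c : R) : differentiable f p ->
  (forall t, 0 < t -> t <= 1 -> t * c <= f (p + t *: v) - f p) ->
  c <= dot (grad f p) v.
Proof.
move=> df h.
have := @dot_sum_grad_ge unit xpredT (fun=> f) (fun=> 1) (fun=> p) v c.
rewrite (big_pred1 tt) ?scale1r; last by case.
apply=> // t t0 t1; rewrite (big_pred1 tt) ?mul1r; last by case.
exact: h.
Qed.

Section Prox.
Context {f : 'rV[R]_d -> R} {p b : 'rV[R]_d} {c : R}.
Hypotheses (c0 : 0 <= c) (df : differentiable f p).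
Hypothesis prox : forall x, f p + c * norm2 (b - p) <= f x + c * norm2 (b - x).

(** The penalty is [c]-Lipschitz, so at the minimizer [f] cannot decrease faster than [c]. *)
Lemma prox_grad_le : norm2 (grad f p) <= c.
Proof.
apply: norm2_le_dual => // v; apply: dot_grad_ge => // t t0 t1.
have := prox (p + t *: v); rewrite opprD addrA.
have : c * norm2 (b - p - t *: v) <= c * (norm2 (b - p) + t * norm2 v).
  rewrite ler_wpM2l//; apply: le_trans (norm2D _ _) _.
  by rewrite norm2N norm2Z gtr0_norm.
lra.
Qed.

(** Moving [p] towards [b] lowers the penalty at rate [c * norm2 (b - p)], which [f] must make up
    for. *)
Lemma prox_grad_dir : c * norm2 (b - p) <= dot (grad f p) (b - p).
Proof.
apply: dot_grad_ge => // t t0 t1.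
have := prox (p + t *: (b - p)).
have -> : b - (p + t *: (b - p)) = (1 - t) *: (b - p).
  by rewrite opprD addrA scalerBl scale1r.
rewrite norm2Z ger0_norm ?subr_ge0//; lra.
Qed.

Lemma prox_grad_ge : p != b -> c <= norm2 (grad f p).
Proof.
move=> pb; have B0 : 0 < norm2 (b - p) by rewrite norm2_gt0// subr_eq0 eq_sym.
by rewrite -(ler_pM2r B0); apply: le_trans prox_grad_dir (dot_le _ _).
Qed.

End Prox.
End FirstOrder.

(** * Collapse of proximal points to their common anchor *)

Section Collapse.
Context {R : realType} {d : nat}.
Implicit Types (p b x : 'rV[R]_d).

(* For [p] minimizing [f y + c * norm2 (b - y)] over [y], [grad f p] is the
   gradient at [b] of the infimal convolution of [f] with [c * norm2], which
   agrees with [f] near [x] because [norm2 (grad f x) < c]. *)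
Lemma prox_growth (f : 'rV[R]_d -> R) p b x (c rho L r : R) :
  0 < rho -> rho <= L -> 0 <= r -> r < norm2 (b - x) ->
  c * norm2 (b - p) <= dot (grad f p) (b - p) ->
  (p != b -> c <= norm2 (grad f p)) ->
  rho * norm2 (p - x) ^+ 2 <= dot (grad f p - grad f x) (p - x) ->
  norm2 (grad f p - grad f x) <= L * norm2 (p - x) ->
  norm2 (grad f x) + L * r < c ->
  rho * r * norm2 (b - x) < dot (grad f p - grad f x) (b - x).
Proof.
move=> rho0 rhoL r0 rT dir far growth lip hc.
have [E|pb] := eqVneq p b.
  rewrite E in growth *; apply: lt_le_trans growth.
  by rewrite -mulrA ltr_pM2l// expr2 ltr_pM2r//; exact: le_lt_trans rT.
have B0 : 0 < norm2 (b - p) by rewrite norm2_gt0// subr_eq0 eq_sym.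
(* By [lip] and [hc], a gradient of norm at least [c] is out of reach within distance [r] of [x]. *)
have ra : r < norm2 (p - x).
  have cL : c <= norm2 (grad f x) + L * norm2 (p - x).
    apply: le_trans (far pb) _; rewrite -[grad f p](subrK (grad f x)).
    by apply: le_trans (norm2D _ _) _; rewrite addrC lerD2l.
  by rewrite -(ltr_pM2l (lt_le_trans rho0 rhoL)); lra.
have a0 : 0 < norm2 (p - x) by exact: le_lt_trans ra.
have Tle := norm2_tri b p x.
have xB := dot_le (grad f x) (b - p).
(* Split [b - x] at [p]: [growth] covers [p - x], and the slope [c - norm2 (grad f x) > L * r]
   covers [b - p]. *)
have -> : dot (grad f p - grad f x) (b - x) = dot (grad f p - grad f x) (p - x)
    + (dot (grad f p) (b - p) - dot (grad f x) (b - p)).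
  by rewrite -dotBl -dotDr [p - x + _]addrC subrKA.
have h1 : rho * r * norm2 (b - x) <= rho * r * (norm2 (b - p) + norm2 (p - x)).
  by rewrite ler_wpM2l// mulr_ge0// ltW.
have h2 : rho * r * norm2 (p - x) < rho * norm2 (p - x) ^+ 2.
  by rewrite -mulrA ltr_pM2l// expr2 ltr_pM2r.
have h3 : rho * r * norm2 (b - p) <= (c - norm2 (grad f x)) * norm2 (b - p).
  rewrite ler_pM2r//; have : rho * r <= L * r by rewrite ler_wpM2r.
  lra.
lra.
Qed.

(** Monotonicity carries the slope [c] in direction [b - p] from [p] to [b], where the gradient is
    too small for it unless [p = b]. *)
Lemma prox_fixed (f : 'rV[R]_d -> R) p b (c : R) :
  0 <= dot (grad f p - grad f b) (p - b) ->
  c * norm2 (b - p) <= dot (grad f p) (b - p) ->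
  norm2 (grad f b) < c -> p = b.
Proof.
move=> mono dir bc; apply/eqP; apply/negPn/negP => pb.
have B0 : 0 < norm2 (b - p) by rewrite norm2_gt0// subr_eq0 eq_sym.
have xB := dot_le (grad f b) (b - p).
have : norm2 (grad f b) * norm2 (b - p) < c * norm2 (b - p) by rewrite ltr_pM2r.
move: mono; rewrite -(opprB b p) dotNr dotBl; lra.
Qed.

(** Summing [prox_growth] over [S] pits the growth rate [rho * r] against the bounds on the gradient
    sums, which forces [norm2 (b - x) <= r]; then [prox_fixed] applies to each [p j]. *)
Lemma prox_collapse (I : finType) (S : {set I}) (f : I -> 'rV[R]_d -> R)
    (w c : I -> R) (p : I -> 'rV[R]_d) b x (rho L r eta : R) :
  (forall j, 0 < w j) -> S != finset.set0 ->
  0 < rho -> rho <= L -> 0 <= r ->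
  (forall j, j \in S -> c j * norm2 (b - p j) <= dot (grad (f j) (p j)) (b - p j)) ->
  (forall j, j \in S -> p j != b -> c j <= norm2 (grad (f j) (p j))) ->
  (forall j, j \in S -> rho * norm2 (p j - x) ^+ 2 <=
    dot (grad (f j) (p j) - grad (f j) x) (p j - x)) ->
  (forall j, j \in S ->
    norm2 (grad (f j) (p j) - grad (f j) x) <= L * norm2 (p j - x)) ->
  (forall j, j \in S -> 0 <= dot (grad (f j) (p j) - grad (f j) b) (p j - b)) ->
  (forall j, j \in S -> norm2 (b - x) <= r ->
    norm2 (grad (f j) b - grad (f j) x) <= L * norm2 (b - x)) ->
  (forall j, j \in S -> norm2 (grad (f j) x) + L * r < c j) ->
  norm2 (\sum_(j in S) w j *: grad (f j) (p j)) <= eta ->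
  norm2 (\sum_(j in S) w j *: grad (f j) x) + eta <=
    rho * r * \sum_(j in S) w j ->
  forall j, j \in S -> p j = b.
Proof.
move=> w0 /set0Pn[j0 j0S] rho0 rhoL r0 dir far growth lip mono lipb hc sumeta hr.
have [bx|xb] := leP (norm2 (b - x)) r => j jS.
  apply: (prox_fixed (mono j jS) (dir j jS)); apply: le_lt_trans (hc j jS).
  rewrite -[grad (f j) b](subrK (grad (f j) x)).
  apply: le_trans (norm2D _ _) _; rewrite addrC lerD2l.
  apply: le_trans (lipb j jS bx) _.
  by rewrite ler_wpM2l// (le_trans (ltW rho0)).
have : dot (\sum_(j in S) w j *: (grad (f j) (p j) - grad (f j) x)) (b - x) <=
    (norm2 (\sum_(j in S) w j *: grad (f j) x) + eta) * norm2 (b - x).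
  under eq_bigr do rewrite scalerBr.
  rewrite sumrB; apply: le_trans (dot_le _ _) _.
  rewrite ler_wpM2r ?norm2_ge0//; apply: le_trans (norm2D _ _) _.
  by rewrite norm2N addrC lerD2l.
move=> /le_trans => /(_ _ (ler_wpM2r (norm2_ge0 _) hr)).
rewrite leNgt => /negP[].
rewrite dot_suml mulrAC mulr_sumr.
apply: ltr_sum; first by apply/hasP; exists j0 => //; rewrite mem_index_enum.
move=> k kS; rewrite dotZl [X in X < _]mulrC ltr_pM2l//.
apply: (prox_growth (c := c k) (L := L)) => //; [exact: dir|exact: far|
  exact: growth|exact: lip|exact: hc].
Qed.

End Collapse.

(** * Consequences of the standing setting *)

Section Setting.
Context {R : realType} {d m : nat} {f : 'I_m -> 'rV[R]_d -> R} {w : 'I_m -> R}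
  {eps delta : R} {thstar : 'I_m -> 'rV[R]_d} {M : \bar R} {rho L : R}
  {S : {set 'I_m}} {lam : R} {Thhat : 'I_m -> 'rV[R]_d} {bhat : 'rV[R]_d}.
Hypothesis setting : settingA2 f w eps delta thstar M rho L S lam Thhat bhat.

Local Notation s j := (Num.sqrt (w j)).
Local Notation smax := (\big[Num.max/0]_(j in S) s j).
Local Notation W := (\sum_(j in S) w j).
Local Notation kappa := (L / rho).
Local Notation kappaw := (smax * (\sum_(j in S) s j) / W).
Local Notation G :=
  (\big[Num.max/0]_(j in S) (s j * norm2 (grad (f j) (thstar j)))).
Local Notation e := (1 - kappa * eps).

Lemma w_gt0 j : 0 < w j. Proof. by have [[]] := setting. Qed.
Lemma rho_gt0 : 0 < rho. Proof. by have [_ [[]]] := setting. Qed.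
Lemma rho_le_L : rho <= L. Proof. by have [_ [[]]] := setting. Qed.
Lemma eps_ge0 : 0 <= eps. Proof. by have [[]] := setting. Qed.
Lemma delta_ge0 : 0 <= delta. Proof. by have [[]] := setting. Qed.

Lemma L_gt0 : 0 < L. Proof. exact: lt_le_trans rho_gt0 rho_le_L. Qed.

Lemma s_gt0 j : 0 < s j. Proof. by rewrite sqrtr_gt0 w_gt0. Qed.

Lemma sqr_s j : s j * s j = w j.
Proof. by rewrite -expr2 sqr_sqrtr// ltW// w_gt0. Qed.

Lemma s_le_smax j : j \in S -> s j <= smax.
Proof. exact: (le_bigmax_cond 0 (fun j => s j)). Qed.

Lemma smax_gt0 : 0 < smax.
Proof.
have [_ [[_ _ /set0Pn[j jS]] _]] := setting.
exact: lt_le_trans (s_gt0 j) (s_le_smax jS).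
Qed.

Lemma W_gt0 : 0 < W.
Proof.
have [_ [[_ _ /set0Pn[j jS]] _]] := setting.
rewrite (bigD1 j)//= ltr_wpDr ?w_gt0// sumr_ge0// => i _.
by rewrite ltW ?w_gt0.
Qed.

Lemma kappa_ge1 : 1 <= kappa.
Proof. by rewrite ler_pdivlMr ?rho_gt0// mul1r rho_le_L. Qed.

Lemma kappaw_ge1 : 1 <= kappaw.
Proof.
rewrite ler_pdivlMr ?W_gt0// mul1r mulr_sumr; apply: ler_sum => j jS.
by rewrite -{1}sqr_s ler_pM2r ?s_gt0// s_le_smax.
Qed.

Lemma G_ge0 : 0 <= G. Proof. exact: bigmax_ge_id. Qed.

Lemma grad_le_G j : j \in S -> s j * norm2 (grad (f j) (thstar j)) <= G.
Proof.
exact: (le_bigmax_cond 0 (fun j => s j * norm2 (grad (f j) (thstar j)))).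
Qed.

Lemma e_gt0 : 0 < e.
Proof. by have [_ [_ [[_ _ _ ?] _]]] := setting; rewrite subr_gt0. Qed.

Lemma e_le1 : e <= 1.
Proof.
rewrite gerBl mulr_ge0 ?eps_ge0//.
exact: le_trans ler01 kappa_ge1.
Qed.

Lemma lam_gt_grad : 5 * (kappa * kappaw * G) < e * lam.
Proof.
have [_ [_ [_ [h _]]]] := setting.
rewrite [e * lam]mulrC -ltr_pdivrMr ?e_gt0//.
by apply: le_lt_trans h; rewrite [leRHS]mulrAC !mulrA.
Qed.

Lemma kappa_kappaw_ge1 : 1 <= kappa * kappaw.
Proof. exact: mulr_ege1 kappa_ge1 kappaw_ge1. Qed.

Lemma lam_gt0 : 0 < lam.
Proof.
have := lam_gt_grad; have : 0 <= kappa * kappaw * G.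
  by rewrite mulr_ge0 ?G_ge0// (le_trans ler01 kappa_kappaw_ge1).
move=> h1 h2; have : 0 < e * lam by lra.
by rewrite pmulr_rgt0 ?e_gt0.
Qed.

Lemma real_radius j : j \in S -> exists Mj : R,
  [/\ 0 < Mj, 2 * lam < rho * s j * Mj & regular_on (f j) (thstar j) Mj rho L].
Proof.
move=> jS; have [[_ _ _ M0] [_ [[reg _ _ _] [_ [lamM _]]]]] := setting.
have rs : 0 < rho * s j by rewrite mulr_gt0 ?s_gt0 ?rho_gt0.
have l0 := lam_gt0.
have [cf tdf hf _] := reg j jS; have := lamM j jS; case: M M0 hf {reg lamM}.
- move=> Mj; rewrite lte_fin => Mj0 hf; rewrite -EFinM lte_fin => h.
  by exists Mj; split=> //; lra.
(* For infinite [M] any radius above [2 * lam / (rho * s j)] does. *)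
- move=> _ hf _; exists (3 * lam / (rho * s j)); split.
  + by rewrite divr_gt0// mulr_gt0.
  + by rewrite [ltRHS]mulrC divfK ?gt_eqF//; lra.
  + by split=> // z _; apply: hf; rewrite leey.
- by rewrite ltNge leNye.
Qed.

Lemma f_diff j x : j \in S -> differentiable (f j) x.
Proof. by move=> /real_radius[Mj [_ _ /regular_on_diff]]. Qed.

Lemma w_lam j : w j * (lam / s j) = s j * lam.
Proof. by rewrite -{1}sqr_s -mulrA [X in _ * X]mulrC divfK // gt_eqF ?s_gt0. Qed.

Lemma lam_s_ge0 j : 0 <= lam / s j.
Proof. by rewrite divr_ge0 ?ltW ?s_gt0// lam_gt0. Qed.

Lemma column_opt j x :
  f j (Thhat j) + lam / s j * norm2 (bhat - Thhat j) <=
  f j x + lam / s j * norm2 (bhat - x).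
Proof.
have [_ [_ [_ [_ [_ opt]]]]] := setting.
have := opt (fun k => if k == j then x else Thhat k) bhat.
rewrite (bigD1 j)//= [leRHS](bigD1 j)//= eqxx.
under [X in _ <= _ + X -> _]eq_bigr => k /negbTE kj do rewrite kj.
by rewrite lerD2r ler_pM2l ?w_gt0.
Qed.

(* Translating the columns in [S] together with [bhat] changes only the
   penalties of the columns outside [S]. *)
Lemma sum_grad_le :
  norm2 (\sum_(j in S) w j *: grad (f j) (Thhat j)) <= eps * W / smax * lam.
Proof.
have [_ [_ [[_ _ out _] [_ [_ opt]]]]] := setting.
have l0 := lam_gt0.
apply: (@le_trans _ _ ((\sum_(j in ~: S) s j) * lam)); last first.
  by rewrite ler_wpM2r// ltW.
apply: norm2_le_dual => [|v].
  by rewrite mulr_ge0 ?(ltW l0)// sumr_ge0// => j _; exact: sqrtr_ge0.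
apply: dot_sum_grad_ge => [j jS|t t0 t1]; first exact: f_diff.
have := opt (fun j => if j \in S then Thhat j + t *: v else Thhat j) (bhat + t *: v).
rewrite (bigID (mem S)) [X in _ <= X -> _](bigID (mem S)) /=.
under [X in _ <= X + _ -> _]eq_bigr => j jS.
  rewrite jS opprD addrACA subrr addr0; over.
under [X in _ <= _ + X -> _]eq_bigr => j /negbTE jS.
  rewrite jS; over.
have -> : \sum_(j in S) w j * (f j (Thhat j + t *: v) - f j (Thhat j)) =
  \sum_(j in S) w j * (f j (Thhat j + t *: v) + lam / s j * norm2 (bhat - Thhat j))
  - \sum_(j in S) w j * (f j (Thhat j) + lam / s j * norm2 (bhat - Thhat j)).
  by rewrite -sumrB; apply: eq_bigr => j _; ring.
(* Outside [S] the triangle inequality bounds each increase by [t * norm2 v] times the slope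
   [w j * (lam / s j) = s j * lam]. *)
have : \sum_(j | j \notin S)
      w j * (f j (Thhat j) + lam / s j * norm2 (bhat + t *: v - Thhat j))
  <= \sum_(j | j \notin S) w j * (f j (Thhat j) + lam / s j * norm2 (bhat - Thhat j))
   + t * ((\sum_(j in ~: S) s j) * lam * norm2 v).
  rewrite !mulr_suml mulr_sumr 
    [X in _ <= _ + X](eq_bigl (fun j => j \notin S)) => [|j]; last by rewrite inE.
  rewrite -big_split /=; apply: ler_sum => j _.
  have penE n : w j * (f j (Thhat j) + lam / s j * n) =
      w j * f j (Thhat j) + s j * lam * n by rewrite mulrDr mulrA w_lam.
  have tri : norm2 (bhat + t *: v - Thhat j) <=
      norm2 (bhat - Thhat j) + t * norm2 v.
    by rewrite addrAC (le_trans (norm2D _ _))// norm2Z gtr0_norm.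
  have := ler_wpM2l (mulr_ge0 (sqrtr_ge0 (w j)) (ltW l0)) tri.
  rewrite !penE; lra.
lra.
Qed.

(** The gradients at the column and at [thstar j] have norms at most [lam / s j] and a fifth of it,
    whence 6/5; [regular_on_near] applies because [2 * lam < rho * s j * Mj]. *)
Lemma radius_bound j : j \in S ->
  5 * (rho * s j) * norm2 (Thhat j - thstar j) <= 6 * lam.
Proof.
move=> jS; have [Mj [Mj0 lamM reg]] := real_radius jS.
have sj := s_gt0 j; have l0 := lam_gt0.
have Gj := grad_le_G jS; have G0 := G_ge0.
have lG : 5 * G <= lam.
  have h : 1 * G <= kappa * kappaw * G by rewrite ler_wpM2r ?kappa_kappaw_ge1.
  have : e * lam <= 1 * lam by rewrite ler_pM2r ?e_le1.
  by have := lam_gt_grad; lra.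
have h := prox_grad_le (lam_s_ge0 j) (f_diff (Thhat j) jS) (column_opt j).
have hl : lam / s j * s j = lam by rewrite divfK ?gt_eqF.
have h' : norm2 (grad (f j) (Thhat j)) + norm2 (grad (f j) (thstar j)) <=
    6 / 5 * (lam / s j).
  rewrite -(ler_pM2r sj) mulrDl -[leRHS]mulrA hl [X in _ + X]mulrC.
  by have := ler_wpM2r (ltW sj) h; rewrite hl; lra.
have KM : 6 / 5 * (lam / s j) < rho * Mj.
  by rewrite -(ltr_pM2r sj) -[ltLHS]mulrA hl; lra.
have := regular_on_near reg Mj0 h' KM.
by rewrite -(ler_pM2r sj) -[leRHS]mulrA hl; lra.
Qed.


(** * The case of small delta *)

Hypothesis lam_ge_delta : 15 * (kappa * kappaw * (L * delta)) <= e * lam.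

Section Center.
Context {x : 'rV[R]_d}.
Hypothesis center : forall j, j \in S -> s j * norm2 (thstar j - x) <= delta.

(** Bounds [s j * norm2 (grad (f j) x)]: [G] at [thstar j] plus the Lipschitz change. *)
Local Notation A := (G + L * delta).

Lemma A_ge0 : 0 <= A.
Proof. by rewrite addr_ge0 ?G_ge0// mulr_ge0 ?delta_ge0// ltW ?L_gt0. Qed.

(* By strong convexity, the weighted sum of the [f j] over [S] plus the
   penalties of the columns outside [S] is minimal within this distance
   from [x]. *)
Definition center_radius := (A * kappaw + eps * lam) / (rho * smax).

Local Notation r := center_radius.

Lemma center_radius_ge0 : 0 <= r.
Proof.
have k0 := le_trans ler01 kappaw_ge1.
rewrite divr_ge0//; last by rewrite ltW// mulr_gt0 ?rho_gt0 ?smax_gt0.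
by rewrite addr_ge0// mulr_ge0 ?A_ge0 ?eps_ge0 ?(ltW lam_gt0).
Qed.

(** Keeps gradients within distance [r] of [x] below the threshold. The left side is at most [2 *
    (kappa * kappaw * A) + kappa * eps * lam], where [kappa * kappaw * A] is below
    [(1/5 + 1/15) * (e * lam)]. *)
Lemma center_margin j : j \in S -> A + s j * (L * r) < lam.
Proof.
move=> jS.
have LrE : smax * (L * r) = kappa * kappaw * A + kappa * eps * lam.
  rewrite /center_radius; set q := kappaw; field.
  by rewrite !gt_eqF ?rho_gt0 ?smax_gt0.
have : s j * (L * r) <= smax * (L * r).
  by rewrite ler_wpM2r ?s_le_smax// mulr_ge0 ?center_radius_ge0// ltW ?L_gt0.
have : 1 * A <= kappa * kappaw * A by rewrite ler_wpM2r ?kappa_kappaw_ge1 ?A_ge0.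
have := lam_gt_grad; have := lam_ge_delta; have l0 := lam_gt0.
have : 0 < e * lam by rewrite mulr_gt0 ?e_gt0.
rewrite {}LrE !(mulrDr (kappa * kappaw)) mulrBl.
lra.
Qed.

(** The factors leave room for [center_balls]: 1/30 + (3/5 + 1/30) and 1/30 + 1/2 are below 1. They
    come from [15 * (L * delta) <= lam] and [center_margin]. *)
Lemma center_near j (Mj : R) : j \in S -> 2 * lam < rho * s j * Mj ->
  30 * norm2 (x - thstar j) <= Mj /\ 2 * r <= Mj.
Proof.
move=> jS lM; have sj := s_gt0 j; have r0 := rho_gt0; have rL := rho_le_L.
have l0 := lam_gt0; have cr0 := center_radius_ge0; have d0 := delta_ge0.
have rs : 0 < rho * s j by rewrite mulr_gt0.
have Ld0 : 0 <= L * delta by rewrite mulr_ge0// ltW ?L_gt0.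
have h15 : 15 * (L * delta) <= lam.
  have : 1 * (L * delta) <= kappa * kappaw * (L * delta).
    by rewrite ler_wpM2r ?kappa_kappaw_ge1.
  have : e * lam <= 1 * lam by rewrite ler_pM2r ?e_le1.
  by have := lam_ge_delta; lra.
split; rewrite -(ler_pM2l rs); apply: le_trans (ltW lM).
- have : rho * delta <= L * delta by rewrite ler_wpM2r.
  have : rho * (s j * norm2 (x - thstar j)) <= rho * delta.
    by rewrite ler_pM2l// norm2B center.
  lra.
- have : rho * (s j * r) <= L * (s j * r).
    by rewrite ler_wpM2r// mulr_ge0// ltW.
  have := center_margin jS; have := A_ge0; lra.
Qed.

Lemma center_grad j : j \in S ->
  norm2 (grad (f j) x - grad (f j) (thstar j)) <= L * norm2 (thstar j - x).
Proof.
move=> jS; have [Mj [Mj0 lamM reg]] := real_radius jS.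
have [xM _] := center_near jS lamM; have n0 := norm2_ge0 (x - thstar j).
rewrite (norm2B (thstar j)).
apply: (regular_on_lipschitz (ltW L_gt0) reg); rewrite subrr norm20; lra.
Qed.

Lemma center_grad_le j : j \in S -> s j * norm2 (grad (f j) x) <= A.
Proof.
move=> jS; have sj := s_gt0 j.
rewrite -[grad (f j) x](subrK (grad (f j) (thstar j))).
apply: (@le_trans _ _ (s j * (L * norm2 (thstar j - x)
    + norm2 (grad (f j) (thstar j))))).
  rewrite ler_pM2l//; apply: le_trans (norm2D _ _) _.
  by rewrite lerD2r center_grad.
have : L * (s j * norm2 (thstar j - x)) <= L * delta.
  by rewrite ler_pM2l ?L_gt0// center.
by have := grad_le_G jS; lra.
Qed.

Lemma center_balls j : j \in S -> exists Mj : R,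
  [/\ regular_on (f j) (thstar j) Mj rho L, norm2 (x - thstar j) <= Mj,
      norm2 (Thhat j - thstar j) <= Mj,
      norm2 (x - thstar j) + norm2 (Thhat j - x) <= Mj &
      norm2 (x - thstar j) + r <= Mj].
Proof.
move=> jS; have [Mj [Mj0 lamM reg]] := real_radius jS.
have [xM rM] := center_near jS lamM; have l0 := lam_gt0.
have n0 := norm2_ge0 (x - thstar j).
have ThM : 5 * norm2 (Thhat j - thstar j) <= 3 * Mj.
  have rs : 0 < rho * s j by rewrite mulr_gt0 ?s_gt0 ?rho_gt0.
  by rewrite -(ler_pM2l rs); have := radius_bound jS; lra.
have n1 := norm2_ge0 (Thhat j - thstar j).
have := norm2_tri (Thhat j) (thstar j) x; rewrite (norm2B (thstar j)).
by exists Mj; split=> //; lra.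
Qed.

Lemma center_collapse j : j \in S -> Thhat j = bhat.
Proof.
have L0 := ltW L_gt0; have cr0 := center_radius_ge0.
have [_ [[_ _ Sn] _]] := setting.
apply: (@prox_collapse _ _ _ S f w (fun k => lam / s k) Thhat bhat x rho L r
  (eps * W / smax * lam)) => //.
- exact: w_gt0.
- exact: rho_gt0.
- exact: rho_le_L.
- by move=> k kS; apply: prox_grad_dir (f_diff _ kS) (column_opt k).
- by move=> k kS; apply: prox_grad_ge (f_diff _ kS) (column_opt k).
- move=> k /center_balls[Mj [reg xM ThM _ _]].
  rewrite -[rho]mulr1; apply: (regular_on_growth reg) => //.
  by rewrite scale1r subrKC.
- move=> k /center_balls[Mj [reg _ _ xTh _]].
  exact: (regular_on_lipschitz L0 reg).
- by move=> k /center_balls[Mj [reg _ _ _ _]]; exact: regular_on_mono reg.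
- move=> k /center_balls[Mj [reg _ _ _ xr]] br.
  by apply: (regular_on_lipschitz L0 reg); lra.
- move=> k kS; rewrite -(ltr_pM2l (s_gt0 k)) mulrDr.
  rewrite [ltRHS]mulrC divfK ?gt_eqF ?s_gt0//.
  by apply: le_lt_trans (center_margin kS); rewrite lerD2r center_grad_le.
- exact: sum_grad_le.
(* [r] is chosen to make the total growth rate equal to the two gradient bounds together. *)
- have rWE : rho * r * W = A * (\sum_(k in S) s k) + eps * W / smax * lam.
    rewrite /center_radius; field.
    by rewrite !gt_eqF ?rho_gt0 ?smax_gt0 ?W_gt0.
  rewrite rWE lerD2r; apply: le_trans (norm2_sum _ _) _.
  rewrite mulr_sumr; apply: ler_sum => k kS.
  rewrite norm2Z ger0_norm ?(ltW (w_gt0 k))// -{1}sqr_s -mulrA.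
  by rewrite [leRHS]mulrC ler_pM2l ?s_gt0// center_grad_le.
Qed.

(** With all columns at [bhat], [sum_grad_le] bounds the gradient sum there. Strong convexity
    compares it with the sum at [x], itself close to the sum at the [thstar k]. *)
Lemma center_dist : rho * W * norm2 (bhat - x) <=
  norm2 (\sum_(k in S) w k *: grad (f k) (thstar k))
  + L * delta * \sum_(k in S) s k + eps * W / smax * lam.
Proof.
have bE k : k \in S -> grad (f k) (Thhat k) = grad (f k) bhat.
  by move=> kS; rewrite center_collapse.
have := sum_grad_le; under eq_bigr => k kS do rewrite bE//.
set gb := \sum_(k in S) w k *: grad (f k) bhat => gb_le.
set gs := \sum_(k in S) w k *: grad (f k) (thstar k).
pose gx := \sum_(k in S) w k *: grad (f k) x.
have gx_le : norm2 gx <= norm2 gs + L * delta * \sum_(k in S) s k.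
  rewrite -[gx](subrK gs); apply: le_trans (norm2D _ _) _.
  rewrite addrC lerD2l -sumrB; apply: le_trans (norm2_sum _ _) _.
  rewrite mulr_sumr; apply: ler_sum => k kS.
  rewrite -scalerBr norm2Z ger0_norm ?(ltW (w_gt0 k))// -{1}sqr_s -[leLHS]mulrA.
  rewrite [leRHS]mulrC ler_pM2l ?s_gt0//.
  apply: (@le_trans _ _ (s k * (L * norm2 (thstar k - x)))).
    by rewrite ler_pM2l ?s_gt0// center_grad.
  by rewrite mulrCA ler_pM2l ?L_gt0// center.
have growth : rho * W * norm2 (bhat - x) ^+ 2 <= dot (gb - gx) (bhat - x).
  rewrite -sumrB dot_suml mulrAC mulr_sumr; apply: ler_sum => k kS.
  rewrite -scalerBr dotZl [leLHS]mulrC ler_pM2l ?w_gt0//.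
  have [Mj [reg xM]] := center_balls kS; rewrite center_collapse// => bM _ _.
  rewrite -[rho]mulr1; apply: (regular_on_growth reg) => //.
  by rewrite scale1r subrKC.
have [T0|T0] := eqVneq (norm2 (bhat - x)) 0.
  rewrite T0 mulr0; apply: le_trans (norm2_ge0 gx) _.
  apply: le_trans gx_le _; rewrite lerDl.
  exact: le_trans (norm2_ge0 _) gb_le.
have {}T0 : 0 < norm2 (bhat - x) by rewrite lt0r T0 norm2_ge0.
rewrite -(ler_pM2r T0) -[leLHS]mulrA -expr2; apply: le_trans growth _.
apply: le_trans (dot_le _ _) _; rewrite ler_pM2r//.
apply: le_trans (norm2D _ _) _; rewrite norm2N addrC; exact: lerD.
Qed.

End Center.

Lemma center_exists : exists x : 'rV[R]_d,
  forall j, j \in S -> s j * norm2 (thstar j - x) <= delta.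
Proof.
have [_ [_ [[_ [x xd] _ _] _]]] := setting; exists x => j jS.
apply: le_trans xd.
exact: (le_bigmax_cond 0 (fun j => s j * norm2 (thstar j - x))).
Qed.

Lemma columns_collapse j : j \in S -> Thhat j = bhat.
Proof. by have [x xd] := center_exists; exact: (center_collapse xd). Qed.

Lemma collapse_dist j : j \in S ->
  norm2 (bhat - thstar j) <=
    norm2 (\sum_(k in S) w k *: grad (f k) (thstar k)) / (rho * W)
    + 2 * (kappa * kappaw * delta) / s j + eps * lam / (rho * smax).
Proof.
move=> jS; have [x xd] := center_exists; have := center_dist xd.
have sj := s_gt0 j; have d0 := delta_ge0; have r0 := rho_gt0.
have W0 := W_gt0; have m0 := smax_gt0; have L0 := L_gt0.
set N := norm2 (\sum_(k in S) _) => T_le.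
have {}T_le : norm2 (bhat - x) <=
    N / (rho * W) + kappa * kappaw * delta / smax + eps * lam / (rho * smax).
  rewrite -(ler_pM2l (mulr_gt0 r0 W0)); apply: le_trans T_le _.
  rewrite le_eqVlt; apply/orP; left; apply/eqP; field.
  by rewrite !gt_eqF.
have xj : norm2 (x - thstar j) <= delta / s j.
  by rewrite norm2B ler_pdivlMr// mulrC xd.
(* The factor 2 collects the distance from [thstar j] to [x] and the delta part of the distance from
   [x] to [bhat]. *)
have kd : delta / s j <= kappa * kappaw * delta / s j.
  by rewrite ler_pM2r ?invr_gt0// -[leLHS]mul1r ler_wpM2r// kappa_kappaw_ge1.
have km : kappa * kappaw * delta / smax <= kappa * kappaw * delta / s j.
  rewrite ler_wpM2l ?lef_pV2 ?posrE ?s_le_smax//.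
  by rewrite mulr_ge0// (le_trans ler01 kappa_kappaw_ge1).
by apply: le_trans (norm2_tri _ x _) _; lra.
Qed.

End Setting.

(** * Error bound and common minimizer *)

Theorem theoremA2 (R : realType) :
  (forall (d m : nat) (f : 'I_m -> 'rV[R]_d -> R) (w : 'I_m -> R) (eps delta : R)
     (thstar : 'I_m -> 'rV[R]_d) (M : \bar R) (rho L : R) (S : {set 'I_m})
     (lam : R) (Thhat : 'I_m -> 'rV[R]_d) (bhat : 'rV[R]_d),
   settingA2 f w eps delta thstar M rho L S lam Thhat bhat ->
   let maxsw := \big[Num.max/0]_(k in S) Num.sqrt (w k) in
   let kappa := L / rho in
   let kappaw := maxsw * (\sum_(k in S) Num.sqrt (w k)) / (\sum_(k in S) w k) in
   forall j, j \in S ->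
     norm2 (Thhat j - thstar j) <=
       norm2 (\sum_(k in S) w k *: grad (f k) (thstar k)) / (rho * \sum_(k in S) w k)
       + 6 / ((1 - kappa * eps) * Num.sqrt (w j))
           * Num.min (3 * kappa ^+ 2 * kappaw * delta) (2 * lam / (5 * rho))
       + eps * lam / (rho * maxsw))
  /\
  (exists C : R,
   forall (d m : nat) (f : 'I_m -> 'rV[R]_d -> R) (w : 'I_m -> R) (eps delta : R)
     (thstar : 'I_m -> 'rV[R]_d) (M : \bar R) (rho L : R) (S : {set 'I_m})
     (lam : R) (Thhat : 'I_m -> 'rV[R]_d) (bhat : 'rV[R]_d),
   settingA2 f w eps delta thstar M rho L S lam Thhat bhat ->
   let maxsw := \big[Num.max/0]_(k in S) Num.sqrt (w k) in
   let kappa := L / rho in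
   let kappaw := maxsw * (\sum_(k in S) Num.sqrt (w k)) / (\sum_(k in S) w k) in
   eps = 0 -> C * kappa * kappaw * L * delta < lam ->
   (* every theta_hat_j equals the (unique) minimizer of sum_k w_k f_k *)
   forall (j : 'I_m) (th : 'rV[R]_d),
     (forall th' : 'rV[R]_d,
        \sum_(k < m) w k * f k th <= \sum_(k < m) w k * f k th')
     <-> th = Thhat j).

Proof.
(* For [eps = 0] the constant 15 gives the small-delta condition of [columns_collapse]. *)
split; [|exists 15] => d m f w eps delta thstar M rho L S lam Thhat bhat
  setting maxsw kappa kappaw.
  move=> j jS.
  have sj := s_gt0 setting j; have r0 := rho_gt0 setting; have W0 := W_gt0 setting.
  have m0 := smax_gt0 setting; have e0 := e_gt0 setting; have e1 := e_le1 setting.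
  have k1 := kappa_ge1 setting; have kk1 := kappa_kappaw_ge1 setting.
  have l0 := lam_gt0 setting; have d0 := delta_ge0 setting.
  have near := radius_bound setting jS.
  rewrite -/maxsw in m0 kk1; rewrite -/kappa in e0 e1 k1 kk1; rewrite -/kappaw in kk1.
  set N := norm2 (\sum_(k in S) _).
  have N0 : 0 <= N / (rho * \sum_(k in S) w k).
    by rewrite divr_ge0 ?norm2_ge0// ltW// mulr_gt0.
  have E0 : 0 <= eps * lam / (rho * maxsw).
    rewrite divr_ge0 ?(ltW (mulr_gt0 r0 m0))//.
    by rewrite mulr_ge0 ?(ltW l0)// (eps_ge0 setting).
  have es : 0 < (1 - kappa * eps) * Num.sqrt (w j) by rewrite mulr_gt0.
  (* Serves both terms of the minimum: the second always, the first when delta is large. *)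
  have near' q : (1 - kappa * eps) * lam <= 5 * rho * q ->
      norm2 (Thhat j - thstar j) <= 6 / ((1 - kappa * eps) * Num.sqrt (w j)) * q.
    move=> hq; rewrite mulrAC ler_pdivlMr//.
    rewrite -(ler_pM2l (_ : 0 < 5 * rho)) ?mulr_gt0//.
    have := ler_wpM2l (ltW e0) near; lra.
  have far : norm2 (Thhat j - thstar j) <= N / (rho * \sum_(k in S) w k) +
    6 / ((1 - kappa * eps) * Num.sqrt (w j)) * (3 * kappa ^+ 2 * kappaw * delta)
    + eps * lam / (rho * maxsw).
    have [small|large] := leP (15 * (kappa * kappaw * (L * delta)))
       ((1 - kappa * eps) * lam).
      rewrite (columns_collapse setting small jS).
      apply: le_trans (collapse_dist setting small jS) _.
      rewrite lerD2r lerD2l.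
      have -> : 6 / ((1 - kappa * eps) * Num.sqrt (w j)) *
          (3 * kappa ^+ 2 * kappaw * delta) =
          18 * (kappa * (kappa * kappaw * delta)) / (1 - kappa * eps)
            / Num.sqrt (w j) by rewrite invfM; ring.
      rewrite ler_pM2r ?invr_gt0//.
      rewrite ler_pdivlMr//.
      have kd : 0 <= kappa * kappaw * delta by rewrite mulr_ge0// (le_trans ler01).
      have h1 : kappa * kappaw * delta * (1 - kappa * eps) <= kappa * kappaw * delta * 1.
        by rewrite ler_wpM2l.
      have h2 : 1 * (kappa * kappaw * delta) <= kappa * (kappa * kappaw * delta).
        by rewrite ler_wpM2r.
      rewrite -/maxsw -/kappa -/kappaw; lra.
    (* For large delta: [15 * (kappa * kappaw * (L * delta))] is [5 * rho] times the first term of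
       the minimum. *)
    apply: le_trans (near' (3 * kappa ^+ 2 * kappaw * delta) _) _; last lra.
    apply: le_trans (ltW large) _.
    have LE : L = kappa * rho by rewrite /kappa divfK// gt_eqF.
    rewrite [X in X * delta]LE; lra.
  rewrite minEle; case: ifP => // _.
  have : norm2 (Thhat j - thstar j) <=
      6 / ((1 - kappa * eps) * Num.sqrt (w j)) * (2 * lam / (5 * rho)).
    apply: near'.
    have -> : 5 * rho * (2 * lam / (5 * rho)) = 2 * lam.
      by rewrite mulrC divfK// gt_eqF// mulr_gt0.
    have : (1 - kappa * eps) * lam <= 1 * lam by rewrite ler_pM2r.
    lra.
  by move=> h; apply: le_trans h _; rewrite addrAC lerDr addr_ge0.
move=> eps0 Cl j th.
have small : 15 * (kappa * kappaw * (L * delta)) <= (1 - kappa * eps) * lam.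
  by rewrite eps0 mulr0 subr0 mul1r; apply: le_trans (ltW Cl); rewrite !mulrA.
(* The positive square roots outside [S] sum to at most 0, so no index lies outside. *)
have Sc : forall k, k \in S.
  move=> k; apply/negPn/negP => kS.
  have [_ [_ [[_ _ out _] _]]] := setting.
  move: out; rewrite eps0 !mul0r (bigD1 k) ?inE//= leNgt => /negP[].
  by rewrite ltr_wpDr ?(s_gt0 setting)// sumr_ge0// => i _; exact: sqrtr_ge0.
have Tb k : Thhat k = bhat by exact: (columns_collapse setting small).
(* Compare with all columns and the center equal to [th']: every penalty vanishes. *)
have bmin th' : \sum_(k < m) w k * f k bhat <= \sum_(k < m) w k * f k th'.
  have [_ [_ [_ [_ [_ /(_ (fun=> th') th')]]]]] := setting.
  under eq_bigr do rewrite Tb subrr norm20 mulr0 addr0.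
  by under [leRHS]eq_bigr do rewrite subrr norm20 mulr0 addr0.
rewrite Tb; split=> [thmin|->//].
have grad0 y : (forall th', \sum_(k < m) w k * f k y <= \sum_(k < m) w k * f k th') ->
    \sum_(k < m) w k *: grad (f k) y = 0.
  move=> ymin; apply: norm2_eq0; apply/eqP; rewrite eq_le norm2_ge0 andbT.
  apply: norm2_le_dual => // v; rewrite mul0r oppr0.
  apply: (dot_sum_grad_ge (p := fun=> y)) => [k _|t t0 t1].
    exact: (f_diff setting).
  rewrite mulr0; under eq_bigr do rewrite mulrBr.
  by rewrite sumrB subr_ge0.
(* A second minimizer contradicts strict monotonicity of the gradients from [bhat], which lies
   inside every ball by [radius_bound]. *)
apply/eqP/negPn/negP => thb.
have : dot (\sum_(k < m) w k *: (grad (f k) th - grad (f k) bhat)) (th - bhat) = 0.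
  under eq_bigr do rewrite scalerBr.
  by rewrite sumrB !grad0// subrr -(scale0r 0) dotZl mul0r.
rewrite dot_suml; apply/eqP; rewrite gt_eqF//.
rewrite [ltLHS](_ : 0 = \sum_(k < m) 0); last by rewrite big1.
apply: ltr_sum => [|k _]; first by apply/hasP; exists j => //; rewrite mem_index_enum.
rewrite dotZl mulr_gt0 ?(w_gt0 setting)//.
have [Mk [Mk0 lamM reg]] := real_radius setting (Sc k).
apply: (regular_on_strict_mono reg) => //; first exact: (rho_gt0 setting).
have := radius_bound setting (Sc k); rewrite Tb => near.
have rs : 0 < rho * Num.sqrt (w k).
  by rewrite mulr_gt0 ?(s_gt0 setting) ?(rho_gt0 setting).
by rewrite -(ltr_pM2l rs); have := lam_gt0 setting; lra.
Qed.
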